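(* There exists a one-dimensional shift space $X$ (over some finite alphabet) with $h(X)>0$ and $\sup h_{ind}(X)=0$.
   Context: Shift spaces. For a finite alphabet $\mathbf{A}$, the full shift is $\mathbf{A}^{\mathbb{Z}}$ with the product topology, and the shift map $\sigma$ is $\sigma(x)_i = x_{i+1}$. A (one-dimensional) shift space over $\mathbf{A}$ is a closed, shift-invariant set $X\subseteq \mathbf{A}^{\mathbb{Z}}$, taken to be nonempty. $B_n(X)$ denotes the set of words of length $n$ over $\mathbf{A}$ that occur in some point of $X$, and $B(X)=\bigcup_{n\ge 0} B_n(X)$. Conjugacy. A sliding block code $\phi: X\to Y$ between shift spaces (possibly over different finite alphabets) is a map of the form $\phi(x)_i = F(x_{i-m}\cdots x_{i+n})$ for all $i \in \mathbb{Z}$, for some fixed integers $m,n$ with $-m\le n$ and some function $F$ on $B_{m+n+1}(X)$. $X$ and $Y$ are (topologically) conjugate, written $Y\simeq X$, if there is a bijective sliding block code between them (its inverse is then also a sliding block code). Topological entropy. $h(X)=\lim_{n\to\infty}\frac1n\ln|B_n(X)|$ (the limit exists). Independence entropy. Let $\hat{\mathbf{A}}$ be the set of nonempty subsets of $\mathbf{A}$. For a finite word $\hat w$ over $\hat{\mathbf{A}}$, let $\Phi(\hat w)$ be the set of words $w$ over $\mathbf{A}$ with $|w|=|\hat w|$ and $w_i\in\hat w_i$ for all $i$. For $\hat x\in\hat{\mathbf{A}}^{\mathbb{Z}}$, let $\Phi(\hat x)=\{x\in\mathbf{A}^{\mathbb{Z}} : x_i\in\hat x_i \text{ for all } i\in\mathbb{Z}\}$.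 The multi-choice shift space of $X$ is $\hat X=\{\hat x\in\hat{\mathbf{A}}^{\mathbb{Z}} : \Phi(\hat x)\subseteq X\}$. The independence entropy of $X$ is $$h_{ind}(X)=\lim_{m\to\infty}\frac{\max\{\ln|\Phi(\hat w)| : \hat w\in B_m(\hat X)\}}{m}$$ (the limit exists). Supremum independence entropy. $\sup h_{ind}(X)=\sup\{h_{ind}(Y) : Y\simeq X\}$, the supremum being over all shift spaces $Y$ (over arbitrary finite alphabets) conjugate to $X$. *)

(* Defs.v *)
From HB Require Import structures.
From mathcomp Require Import all_boot all_order all_algebra.
From mathcomp Require Import all_classical all_reals all_analysis.

Set Implicit Arguments.
Unset Strict Implicit.
Unset Printing Implicit Defensive.

Import Order.TTheory GRing.Theory Num.Theory.
Import numFieldNormedType.Exports.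

Local Open Scope classical_set_scope.
Local Open Scope ring_scope.

Definition shift_map (A : Type) (x : int -> A) : int -> A := fun i => x (i + 1).

(* Closedness is in the product over [int] of the discrete topology on [A]. *)
Definition shift_space (A : finType) (X : set (int -> A)) : Prop :=
  [/\ X !=set0,
      closed (X : set {ptws int -> discrete_topology A}) &
      @shift_map A @` X = X].

Definition window (A : Type) (x : int -> A) (i : int) (n : nat) : n.-tuple A :=
  [tuple x (i + j%:Z) | j < n].

Definition blocks (A : finType) (X : set (int -> A)) (n : nat) :
    {set n.-tuple A} :=
  [set w : n.-tuple A | `[< exists2 x, X x & exists i, window x i n = w >]]%SET.

(* [F] is total on words and only its values on words occurring in [X] matter:
   since the target is nonempty, every function on the blocks of [X] extends.
   Likewise only the values of [phi] on [X] matter. *)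
Definition sliding_block_code (A B : finType)
    (X : set (int -> A)) (Y : set (int -> B)) (phi : (int -> A) -> int -> B) :
    Prop :=
  set_fun X Y phi /\
  exists m n : int, - m <= n /\
  exists F : (absz (m + n + 1)).-tuple A -> B,
  forall x, X x -> forall i, phi x i = F (window x (i - m) (absz (m + n + 1))).

Definition conjugate (A B : finType)
    (X : set (int -> A)) (Y : set (int -> B)) : Prop :=
  exists2 phi, sliding_block_code X Y phi & set_bij X Y phi.

Definition entropy (R : realType) (A : finType) (X : set (int -> A)) : R :=
  limn (fun n : nat => ln (#|blocks X n|%:R : R) / n%:R).

Definition multi (A : finType) : finType :=
  {S : {set A} | S != finset.set0}.

Definition word_choices (A : finType) (n : nat) (w : n.-tuple (multi A)) :
    {set n.-tuple A} :=
  [set v : n.-tuple A | [forall i, tnth v i \in val (tnth w i)]]%SET.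

Definition point_choices (A : finType) (x : int -> multi A) : set (int -> A) :=
  [set y | forall i, y i \in val (x i)].

Definition multi_choice (A : finType) (X : set (int -> A)) :
    set (int -> multi A) :=
  [set x | point_choices x `<=` X].

(* Every [word_choices w] is nonempty, so the logarithms are nonnegative and
   the base value [0] does not affect a maximum over a nonempty set of words. *)
Definition ind_entropy (R : realType) (A : finType) (X : set (int -> A)) : R :=
  limn (fun m : nat =>
    (\big[Num.max/0]_(w in blocks (multi_choice X) m)
       ln (#|word_choices w|%:R : R)) / m%:R).

(* The supremum is taken in the extended reals, hence is the least upper bound
   whether or not the set is bounded. *)
Definition sup_ind_entropy (R : realType) (A : finType) (X : set (int -> A)) :
    \bar R :=
  ereal_sup [set h : \bar R | exists (B : finType) (Y : set (int -> B)),
    [/\ shift_space Y, conjugate X Y & h = (ind_entropy R Y)%:E]].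

(* Main.v *)
Require Import Defs.
From mathcomp Require Import all_boot all_order all_algebra.
From mathcomp Require Import all_classical all_reals all_analysis.
From mathcomp Require Import zify ring.
Import Order.TTheory GRing.Theory Num.Theory.
Import numFieldNormedType.Exports.
Set Implicit Arguments.
Unset Strict Implicit.
Unset Printing Implicit Defensive.
Local Open Scope classical_set_scope.
Local Open Scope ring_scope.

(** Two configurations are homoclinic when they differ at finitely many sites
    only. A multi-choice point of a shift space [Y] which offers several choices
    yields several pairwise homoclinic points of [Y]. Hence, if no three distinct
    points of [Y] are pairwise homoclinic, every word of the multi-choice shift
    admits at most two choices, and the independence entropy of [Y] is zero
    ([ind_entropy0]). By compactness the inverse of a bijective sliding block code
    is local, so that this property of homoclinic classes is a conjugacy invariant
    ([conjugate_homoclinic_le2]). It remains to find one shift space of positive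
    entropy whose homoclinic classes have at most two points.

    Put [m_k = 2 ^ (k + 2)] and [n_k = m_0 * ... * m_(k-1)]. Points of the space
    carry at each site a bit and a mark. Fix an offset [z] and cut the line into
    blocks of length [n_(k+1)] starting at [z]; in every such block and for every
    residue [r < n_k], the [m_k] bits at the sites of the block congruent to
    [z + r] modulo [n_k] are required to sum to zero, for all levels [k]. The mark
    of a site [i <> z] is the parity of the largest [k] such that [n_k] divides
    [i - z]; the mark of [z] is free. In order to obtain a closed set, the space
    consists of the points which, for every [K], satisfy these requirements for
    all [k < K] and some offset depending on [K].

    - Two homoclinic points share their offsets modulo each [n_k], as these can be
      read off the marks arbitrarily far out ([homoclinic_offset]). If their bits
      differed, then for [n_k] larger than the diameter of the set of differences
      one of the checksums would contain exactly one difference, and could not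
      vanish for both points ([homoclinic_bits]). The marks may differ at one site
      at most, where [n_k] divides [i - z] for all [k] ([homoclinic_marks]). Marks
      being binary, a homoclinic class has at most two points.

    - A block of length [n_K] carries [n_K / m_k] checksums of level [k], hence at
      most [n_K / 2] checksums of levels [k < K] in total; so at least
      [2 ^ (n_K / 2)] words of length [n_K] satisfy them. Each such word [w]
      extends to a point of the space: replace [w] by [w w 0 ... 0] of length
      [n_(K+1)], and so on, two equal copies having sum zero. Since the limit
      defining the entropy exists by Fekete's lemma, the entropy is at least
      [ln 2 / 2] ([entropy_checksum_shift_gt0]). *)

(** * Configurations over a finite alphabet *)

(** [x] and [y] coincide on the sites of absolute value at most [N]. *)
Definition agree (T : Type) (N : nat) (x y : int -> T) :=
  forall i : int, (`|i| <= N)%N -> x i = y i.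

Lemma nbhs_agree (A : finType) (x : {ptws int -> discrete_topology A}) N :
  nbhs x [set y : int -> A | agree N x y].
Proof.
have near_coord (i : int) : nbhs x [set y : int -> A | x i = y i].
  have /(_ [set a | x i = a]) :=
    @proj_continuous _ (fun _ : int => discrete_topology A) i x.
  by apply; rewrite nbhs_principalE; exact/principal_filterP.
have /(@filter_forall _ _ _ _ (nbhs_filter x)) : forall k : 'I_(2 * N).+1,
  nbhs x [set y : int -> A | x (k%:Z - N%:Z) = y (k%:Z - N%:Z)] by [].
move=> near_all.
apply: (@filterS _ _ (nbhs_filter x) _ _ _ near_all) => y xy i leiN.
have lt_i : (`|(i + N%:Z)%R| < (2 * N).+1)%N by lia.
have := xy (Ordinal lt_i); suff -> : `|(i + N%:Z)%R|%N%:Z - N%:Z = i by [].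
lia.
Qed.

(** A set of configurations is closed iff it contains every configuration all of
    whose central windows are windows of members of the set. *)
Lemma closed_agreeP (A : finType) (S : set (int -> A)) :
  closed (S : set {ptws int -> discrete_topology A}) <->
  forall x, (forall N, exists2 y, S y & agree N x y) -> S x.
Proof.
split=> [cS x xS|xS x clx]; last first.
  by apply: xS => N; have [y [Sy ?]] := clx _ (nbhs_agree x N); exists y.
have [u uS xu] : exists2 u : nat -> int -> A,
    (forall N, S (u N)) & (forall N, agree N x (u N)).
  exists (fun N => s2val (cid2 (xS N))) => N; first exact: s2valP.
  exact: s2valP'.
have ux : u @ \oo --> (x : {ptws int -> discrete_topology A}).
  apply/cvg_sup => i B; rewrite nbhsE /= => -[W [[V _ VW] Wx] WB].
  exists `|i|%N => // n /= lein; apply: WB.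
  by rewrite -VW /= -xu //; move: Wx; rewrite -VW.
apply: (closed_cvg _ cS _ _ ux).
by exists 0%N => // N _; exact: uS.
Qed.

(** A sequence of configurations over a finite alphabet accumulates, in the
    product topology, at some configuration. *)
Lemma cluster_config (A : finType) (u : nat -> int -> A) :
  exists x, forall N, exists2 n, (N <= n)%N & agree N x (u n).
Proof.
have cA (i : int) : compact [set: discrete_topology A].
  exact/finite_compact/finite_finset.
have [|x [_ clx]] := tychonoff cA (fmap_proper_filter u eventually_filter).
  by exists 0%N.
exists x => N.
have [||y [[n /= leNn <-] xy]] := clx [set u n | n in [set n | (N <= n)%N]]
  [set y | agree N x y].
- by exists N => // n /= leNn; exists n.
- exact: nbhs_agree.
by exists n.
Qed.

(** * Homoclinic points and conjugacy *)

(** Two configurations are homoclinic when they differ at finitely many sites. *)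
Definition homoclinic (T : Type) (x y : int -> T) :=
  exists N : nat, forall i : int, (N < `|i|)%N -> x i = y i.

(** Each class of homoclinic points of [X] has at most two elements. Homoclinicity
    of [y] and [z] follows by transitivity. *)
Definition homoclinic_classes_le2 (T : Type) (X : set (int -> T)) :=
  forall x y z, X x -> X y -> X z ->
    homoclinic x y -> homoclinic x z -> [\/ x = y, x = z | y = z].

Lemma shift_space_shift (A : finType) (X : set (int -> A)) x (k : int) :
  shift_space X -> X x -> X (fun i => x (i + k)).
Proof.
move=> [_ _ shX]; case: k => n.
  elim: n x => [|n IH] x Xx; first by under eq_fun do rewrite addr0.
  have /IH : X (shift_map x) by rewrite -shX; exists x.
  by congr X; apply/funext => i; rewrite /shift_map; congr x; lia.
elim: n x => [|n IH] x; rewrite -{1}shX => -[y Xy <-].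
  by move: Xy; congr X; apply/funext => i; rewrite /shift_map; congr y; lia.
move/IH: Xy; congr X; apply/funext => i; rewrite /shift_map; congr y; lia.
Qed.

Section SlidingBlockCode.
Variables (A B : finType) (X : set (int -> A)) (Y : set (int -> B)).
Variable phi : (int -> A) -> int -> B.
Hypothesis code_phi : sliding_block_code X Y phi.

Lemma code_shift x (k i : int) : shift_space X -> X x ->
  phi (fun j => x (j + k)) i = phi x (i + k).
Proof.
move=> shX Xx; have [_ [m [n [_ [F FE]]]]] := code_phi.
rewrite !FE //; last exact: (shift_space_shift k shX Xx).
by congr F; apply: eq_from_tnth => j; rewrite !tnth_mktuple; congr x; lia.
Qed.

Lemma code_local : exists L : nat, forall x x' i, X x -> X x' ->
  (forall j : int, (`|(j - i)%R| <= L)%N -> x j = x' j) -> phi x i = phi x' i.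
Proof.
have [_ [m [n [le_mn [F FE]]]]] := code_phi.
exists (`|m| + `|n|)%N => x x' i Xx Xx' xx'; rewrite !FE //.
congr F; apply: eq_from_tnth => j; rewrite !tnth_mktuple; apply: xx'.
by have := ltn_ord j; lia.
Qed.

(** The coordinate [x 0] is determined by a bounded window of [phi x]: otherwise
    a limit of pairs of points with different [0]-coordinates, whose images agree
    on longer and longer windows, violates injectivity. *)
Lemma code_inverse_local : shift_space X -> set_inj X phi ->
  exists N : nat, forall x x', X x -> X x' ->
    agree N (phi x) (phi x') -> x 0 = x' 0.
Proof.
move=> shX inj_phi; apply: contrapT => noN.
(* The two points are stored as one configuration of pairs, so that a single
   accumulation point yields both limits. *)
have bad (N : nat) : exists p : int -> A * A,
    [/\ X (fst \o p), X (snd \o p), agree N (phi (fst \o p)) (phi (snd \o p))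
      & (p 0).1 <> (p 0).2].
  apply: contrapT => noP; apply: noN; exists N => x x' Xx Xx' xx'.
  by apply: contrapT => x0; apply: noP; exists (fun i => (x i, x' i)).
pose u N := projT1 (cid (bad N)).
have uP N : [/\ X (fst \o u N), X (snd \o u N),
    agree N (phi (fst \o u N)) (phi (snd \o u N))
    & (u N 0).1 <> (u N 0).2] by exact: (projT2 (cid (bad N))).
have [p pu] := cluster_config u.
have [_ /closed_agreeP clX _] := shX.
have X1 : X (fst \o p).
  apply: clX => N; have [n _ pn] := pu N.
  exists (fst \o u n); first by have [] := uP n.
  by move=> i /pn /= ->.
have X2 : X (snd \o p).
  apply: clX => N; have [n _ pn] := pu N.
  exists (snd \o u n); first by have [] := uP n.
  by move=> i /pn /= ->.
have [L Lphi] := code_local.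
have phip : phi (fst \o p) = phi (snd \o p).
  apply/funext => i; have [n len pn] := pu (`|i| + L)%N.
  have [Xu1 Xu2 uu _] := uP n.
  rewrite (Lphi _ (fst \o u n) i X1 Xu1); last first.
    by move=> j ji /=; rewrite pn //; lia.
  rewrite (Lphi _ (snd \o u n) i X2 Xu2); last first.
    by move=> j ji /=; rewrite pn //; lia.
  by apply: uu; lia.
have p12 : fst \o p = snd \o p by apply: inj_phi phip; apply/mem_set.
have [n _ pn] := pu 0%N; have [_ _ _] := uP n; apply.
by rewrite -pn // -[LHS]/((fst \o p) 0) p12.
Qed.

(** Apply the previous lemma to the translates of [x] and [x'] which bring a far
    site to the origin. *)
Lemma code_homoclinic x x' : shift_space X -> set_inj X phi -> X x -> X x' ->
  homoclinic (phi x) (phi x') -> homoclinic x x'.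
Proof.
move=> shX inj_phi Xx Xx' [M yy'].
have [N phiN] := code_inverse_local shX inj_phi.
exists (M + N)%N => i ltMi.
have := phiN _ _ (shift_space_shift i shX Xx) (shift_space_shift i shX Xx').
rewrite add0r; apply => j lejN; rewrite !code_shift //; apply: yy'; lia.
Qed.

End SlidingBlockCode.

Lemma conjugate_homoclinic_le2 (A B : finType) (X : set (int -> A))
    (Y : set (int -> B)) :
  shift_space X -> conjugate X Y ->
  homoclinic_classes_le2 X -> homoclinic_classes_le2 Y.
Proof.
move=> shX [phi cphi [_ inj_phi surj_phi]] HX y1 y2 y3.
move=> /surj_phi[x1 X1 <-] /surj_phi[x2 X2 <-] /surj_phi[x3 X3 <-] h12 h13.
have {}h12 := code_homoclinic cphi shX inj_phi X1 X2 h12.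
have {}h13 := code_homoclinic cphi shX inj_phi X1 X3 h13.
by have [->|->|->] := HX _ _ _ X1 X2 X3 h12 h13; constructor.
Qed.

Lemma conjugate_refl (A : finType) (X : set (int -> A)) : conjugate X X.
Proof.
exists id; last by split=> // x Xx; exists x.
split=> //; exists 0, 0; split=> //.
exists (fun w => tnth w ord0) => x Xx i.
by rewrite tnth_mktuple subr0 addr0.
Qed.

(** * Independence entropy *)

(** The choices for a word of [multi_choice Y], completed by one fixed choice
    outside the window, are pairwise homoclinic points of [Y]. *)
Lemma card_word_choices_le2 (B : finType) (Y : set (int -> B)) m
    (w : m.-tuple (multi B)) :
  homoclinic_classes_le2 Y -> w \in blocks (multi_choice Y) m ->
  (#|word_choices w| <= 2)%N.
Proof.
move=> HY; rewrite inE => /asboolP[yh Yyh [i0 wE]].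
have base (i : int) : {b : B | b \in val (yh i)}.
  by apply/cid/set0Pn; exact: (valP (yh i)).
pose fill (v : m.-tuple B) (i : int) :=
  if i0 <= i then
    if insub `|(i - i0)%R|%N is Some j then tnth v j else sval (base i)
  else sval (base i).
have fillE v (j : 'I_m) : fill v (i0 + j%:Z) = tnth v j.
  rewrite /fill ifT ?lerDl // addrC addKr /=.
  by rewrite insubT //= => lt_jm; congr tnth; apply: val_inj.
have fillY v : v \in word_choices w -> Y (fill v).
  rewrite inE => /forallP vw; apply: Yyh => i /=.
  rewrite /fill; case: ifP => [le_i|_]; last exact: (svalP (base i)).
  case: insubP => [j _ jE|_]; last exact: (svalP (base i)).
  have := vw j; rewrite -wE tnth_mktuple.
  by congr (_ \in val (yh _)); rewrite jE; lia.
have fill_inj v v' : fill v = fill v' -> v = v'.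
  by move=> vv'; apply: eq_from_tnth => j; rewrite -!fillE vv'.
have fill_hom v v' : homoclinic (fill v) (fill v').
  exists (`|i0| + m)%N => i lt_i; rewrite /fill; case: ifP => // le_i.
  by case: insubP => // j; lia.
rewrite leqNgt; apply/negP => /card_gt2P[v1 [v2 [v3 [[w1 w2 w3] [n12 n23 n31]]]]].
have := HY _ _ _ (fillY _ w1) (fillY _ w2) (fillY _ w3)
  (fill_hom v1 v2) (fill_hom v1 v3).
by case=> /fill_inj vE; [move: n12|move: n31|move: n23]; rewrite vE eqxx.
Qed.

Lemma cvg_div_nat (R : realType) (c : R) : c / n%:R @[n --> \oo] --> 0.
Proof.
rewrite -[0](mulr0 c); apply: cvgMr.
by rewrite -cvg_shiftS; exact: cvg_harmonic.
Qed.

Lemma ind_entropy0 (R : realType) (B : finType) (Y : set (int -> B)) :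
  homoclinic_classes_le2 Y -> ind_entropy R Y = 0.
Proof.
move=> HY; apply/cvg_lim => //.
apply: (squeeze_cvgr _ (cvg_cst 0) (cvg_div_nat (ln 2))).
apply: nearW => m; apply/andP; split.
  by rewrite divr_ge0 // bigmax_ge_id.
rewrite ler_wpM2r ?invr_ge0 //; apply: bigmax_le => [|w wY].
  by rewrite ln_ge0 // ler1n.
have := card_word_choices_le2 HY wY; rewrite leq_eqVlt => /predU1P[-> //|].
rewrite ltnS -(ler_nat R) => w1; apply: (@le_trans _ _ 0).
  exact: ln_le0.
by rewrite ln_ge0 // ler1n.
Qed.

(** * Entropy as the limit of a subadditive sequence *)

(** Fekete's lemma for nonnegative sequences. The limit is the infimum of the
    quotients [a n / n] over [n > 0]: dividing [n] by a fixed [p] with remainder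
    gives [a n / n <= a p / p + C / n], [C] bounding the [a r] with [r < p]. *)
Lemma fekete_cvg (R : realType) (a : nat -> R) :
  (forall n, 0 <= a n) -> (forall m n, a (m + n)%N <= a m + a n) ->
  cvgn (fun n => a n / n%:R).
Proof.
move=> a_ge0 a_sub.
pose E := [set a n.+1 / n.+1%:R | n in [set: nat]].
have E_lb : has_lbound E.
  by exists 0 => _ [n _ <-]; rewrite divr_ge0.
have E_inf : has_inf E by split=> //; exists (a 1%N / 1%:R), 0%N.
have a_mul q p r : a (q * p + r)%N <= q%:R * a p + a r.
  elim: q => [|q IH]; first by rewrite mul0n add0n mul0r add0r.
  rewrite mulSn -addnA; apply: le_trans (a_sub _ _) _.
  by rewrite -natr1 mulrDl mul1r addrAC [leRHS]addrC lerD2l.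
apply/cvg_ex; exists (inf E); apply/cvgrPdist_le => e e0.
have e20 : 0 < e / 2 by rewrite divr_gt0.
have [_ [p _ <-] ltp] := inf_adherent e20 E_inf.
pose C := \sum_(r < p.+1) a r.
have arC (r : nat) : (r < p.+1)%N -> a r <= C.
  move=> ltr; rewrite /C (bigD1 (Ordinal ltr)) //= lerDl.
  by apply: sumr_ge0.
have /cvgrPdist_le/(_ _ e20) := @cvg_div_nat R C.
apply: filterS2 (nbhs_infty_gt 0%N) => n n0.
rewrite sub0r normrN => leC.
have n0R : (0 : R) < n%:R by rewrite ltr0n.
have le_inf : inf E <= a n / n%:R.
  by apply: ge_inf => //; exists n.-1 => //; rewrite prednK.
rewrite ler_distl; apply/andP; split; last first.
  by apply: le_trans le_inf _; rewrite lerDl ltW.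
have : a n / n%:R <= a p.+1 / p.+1%:R + C / n%:R.
  rewrite ler_pdivrMr // mulrDl mulfVK ?gt_eqF //.
  rewrite {1}(divn_eq n p.+1); apply: le_trans (a_mul _ _ _) _.
  apply: lerD; last by rewrite arC // ltn_pmod.
  rewrite [leLHS]mulrC -mulrA ler_wpM2l // mulrC ler_pdivlMr // -natrM ler_nat.
  exact: leq_trunc_div.
move: leC; rewrite ler_norml => /andP[_ leC].
move=> le_a; rewrite lerBlDr (splitr e) addrA.
exact: le_trans le_a (lerD (ltW ltp) leC).
Qed.

Lemma card_blocks_subadd (A : finType) (X : set (int -> A)) m n :
  (#|blocks X (m + n)| <= #|blocks X m| * #|blocks X n|)%N.
Proof.
pose cut (w : (m + n).-tuple A) :=
  ([tuple tnth w (lshift n j) | j < m], [tuple tnth w (rshift m j) | j < n]).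
have cut_inj : injective cut.
  move=> v w vw; apply: eq_from_tnth => i; rewrite -(fintype.splitK i).
  case: (fintype.split i) => j /=.
    by have := congr1 (fun p => tnth p.1 j) vw; rewrite !tnth_mktuple.
  by have := congr1 (fun p => tnth p.2 j) vw; rewrite !tnth_mktuple.
rewrite -cardsX -(card_imset _ cut_inj); apply: subset_leq_card.
apply/fintype.subsetP => _ /imsetP[w wX ->].
move: wX; rewrite inE => /asboolP[x Xx [i <-]]; rewrite !inE.
apply/andP; split; apply/asboolP; exists x => //; [exists i|exists (i + m%:Z)].
  by apply: eq_from_tnth => j; rewrite !tnth_mktuple.
by apply: eq_from_tnth => j; rewrite !tnth_mktuple /= PoszD addrA.
Qed.

(** As the quotients defining the entropy converge, it suffices to bound them
    from below for arbitrarily large [n]. *)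
Lemma entropy_ge (R : realType) (A : finType) (X : set (int -> A)) (c : R) :
  X !=set0 ->
  (forall N, exists2 n, (N < n)%N & c * n%:R <= ln (#|blocks X n|%:R)) ->
  c <= entropy R X.
Proof.
move=> [x0 Xx0] large.
have blocks_gt0 n : (0 < #|blocks X n|)%N.
  apply/card_gt0P; exists (window x0 0 n); rewrite inE; apply/asboolP.
  by exists x0 => //; exists 0.
pose a n : R := ln (#|blocks X n|%:R).
have a_ge0 n : 0 <= a n by rewrite ln_ge0 // ler1n.
have a_sub m n : a (m + n)%N <= a m + a n.
  rewrite -lnM ?posrE ?ltr0n // -natrM ler_ln ?posrE ?ltr0n ?muln_gt0 ?blocks_gt0 //.
  by rewrite ler_nat card_blocks_subadd.
have cvg_a := fekete_cvg a_ge0 a_sub.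
rewrite leNgt; apply/negP => /(cvgr_lt _ cvg_a)[N _ small].
have [n ltNn cn] := large N.
have := small n (ltnW ltNn); rewrite /= ltr_pdivrMr ?ltr0n; last by case: (n) ltNn.
by rewrite ltNge cn.
Qed.

(** * The checksum shift *)

(** The number of summands of a checksum of level [k]. It grows fast enough for
    the densities [1 / ratio k] of the checksums to have sum [1 / 2]. *)
Definition ratio (k : nat) : nat := (2 ^ k.+2)%N.

(** The length of the blocks of level [k]. *)
Fixpoint scale (k : nat) : nat :=
  if k is k'.+1 then (ratio k' * scale k')%N else 1%N.

(** A letter is a bit together with a mark. *)
Definition letter : finType := ('F_2 * bool)%type.

(** The [j]-th site of the checksum of level [k] given by the residue [r], in the
    [q]-th block of length [scale k.+1] counted from the offset [z]. *)
Definition cell (k : nat) (z q : int) (r j : nat) : int :=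
  z + q * (scale k.+1)%:Z + (r + j * scale k)%N%:Z.

(** All checksums of level [k] vanish. *)
Definition balanced (b : int -> 'F_2) (z : int) (k : nat) :=
  forall (q : int) (r : nat), (r < scale k)%N ->
    \sum_(j < ratio k) b (cell k z q r j) = 0.

(** Every site of level exactly [k] carries the parity of [k] as its mark. *)
Definition ruled (s : int -> bool) (z : int) (k : nat) :=
  forall i : int, (scale k %| i - z)%Z -> ~~ (scale k.+1 %| i - z)%Z ->
    s i = odd k.

(** The requirements of the levels below [K], relative to the offset [z]. *)
Definition aligned (K : nat) (z : int) (x : int -> letter) :=
  forall k, (k < K)%N -> balanced (fst \o x) z k /\ ruled (snd \o x) z k.

(** The offset is allowed to depend on [K]. Since only its class modulo [scale K]
    matters, it ranges over a finite set for each [K], whence closedness. *)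
Definition checksum_shift : set (int -> letter) :=
  [set x | forall K, exists z, aligned K z x].

Lemma scaleS k : scale k.+1 = (ratio k * scale k)%N.
Proof. by []. Qed.

Lemma cellE k z q r j :
  cell k z q r j =
  z + (q * (ratio k)%:Z + j%:Z) * (scale k)%:Z + r%:Z.
Proof.
by rewrite /cell scaleS (PoszM (ratio k)) PoszD (PoszM j); ring.
Qed.

Lemma ratio_ge2 k : (2 <= ratio k)%N.
Proof. by rewrite /ratio expnS leq_pmulr ?expn_gt0. Qed.

Lemma ltn_scale k : (k < scale k)%N.
Proof.
elim: k => //= k IH; apply: leq_trans (leq_mul (ratio_ge2 k) IH).
by rewrite mul2n -addnn addSn ltnS leq_addl.
Qed.

Lemma scale_gt0 k : (0 < scale k)%N.
Proof. exact: leq_ltn_trans (ltn_scale k). Qed.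

Lemma dvdn_scale k l : (k <= l)%N -> (scale k %| scale l)%N.
Proof.
move=> /subnK <-; elim: (l - k)%N => //= d IH; exact: dvdn_mull.
Qed.

Lemma dvdz_scale k l (m : int) :
  (k <= l)%N -> (scale l %| m)%Z -> (scale k %| m)%Z.
Proof. by move=> /dvdn_scale kl; exact: dvdn_trans. Qed.

Lemma balanced_mod b z z' k :
  (scale k.+1 %| z' - z)%Z -> balanced b z k -> balanced b z' k.
Proof.
move=> /dvdzP[t tE] bz q r ltr; rewrite -[RHS](bz (t + q) r ltr).
apply: eq_bigr => j _; congr b; rewrite /cell mulrDl -tE; ring.
Qed.

Lemma ruled_mod s z z' k :
  (scale k.+1 %| z' - z)%Z -> ruled s z k -> ruled s z' k.
Proof.
move=> zz' sz i; have -> : i - z' = (i - z) - (z' - z) by ring.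
have zz'k := dvdz_scale (leqnSn k) zz'.
by rewrite (rpredBr _ zz'k) (rpredBr _ zz'); exact: sz.
Qed.

Lemma aligned_mod K z z' x :
  (scale K %| z' - z)%Z -> aligned K z x -> aligned K z' x.
Proof.
move=> zz' xz k ltk; have [bz sz] := xz k ltk.
have zz'k := dvdz_scale ltk zz'.
by split; [exact: balanced_mod bz|exact: ruled_mod sz].
Qed.

Lemma aligned_shift K z t x :
  aligned K z x -> aligned K (z - t) (fun i => x (i + t)).
Proof.
move=> xz k ltk; have [bz sz] := xz k ltk; split.
  move=> q r ltr; rewrite -[RHS](bz q r ltr); apply: eq_bigr => j _ /=.
  by congr (x _).1; rewrite /cell; ring.
move=> i; have -> : i - (z - t) = i + t - z by ring.
exact: sz.
Qed.

Lemma aligned_closed K z x :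
  (forall N, exists2 y, aligned K z y & agree N x y) -> aligned K z x.
Proof.
move=> xy k ltk; split=> [q r ltr|i].
  have [y yz xy_N] := xy (\max_(j < ratio k) `|cell k z q r j|)%N.
  rewrite -[RHS]((yz k ltk).1 q r ltr); apply: eq_bigr => j _ /=.
  by rewrite xy_N // (leq_bigmax (F := fun j : 'I__ => `|cell k z q r j|%N)).
have [y yz xy_N] := xy `|i|%N; have := (yz k ltk).2 i.
by rewrite /= xy_N.
Qed.

(** Otherwise each of the finitely many offsets modulo [scale K] fails for [x] on
    some finite window, and all of them fail on the largest of these windows. *)
Lemma checksum_shift_closed x :
  (forall N, exists2 y, checksum_shift y & agree N x y) -> checksum_shift x.
Proof.
move=> xX K; apply: contrapT => noz.
have bad (z : 'I_(scale K)) : exists N : nat, forall y,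
    agree N x y -> ~ aligned K z%:Z y.
  apply: contrapT => noN; apply: noz; exists z%:Z; apply: aligned_closed => N.
  apply: contrapT => noy; apply: noN; exists N => y xy yz.
  by apply: noy; exists y.
pose M z := projT1 (cid (bad z)); have MP z : forall y,
    agree (M z) x y -> ~ aligned K z%:Z y by exact: projT2 (cid (bad z)).
have [y /(_ K)[z yz] xy] := xX (\max_z M z)%N.
have sc0 : (scale K)%:Z != 0 by rewrite eqz_nat -lt0n scale_gt0.
have ltz : (`|(z %% scale K)%Z| < scale K)%N.
  by have := ltz_mod z sc0; have := modz_ge0 z sc0; lia.
apply: (MP (Ordinal ltz) y).
  by move=> i lei; apply: xy; apply: leq_trans lei _; exact: leq_bigmax.
apply: aligned_mod yz; rewrite /= gez0_abs ?modz_ge0 //.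
have -> : (z %% scale K)%Z - z = - (z %/ scale K)%Z * scale K.
  by rewrite [X in _ - X = _](divz_eq z (scale K)); ring.
by rewrite dvdz_mull.
Qed.

Lemma shift_space_checksum_shift : checksum_shift !=set0 ->
  shift_space checksum_shift.
Proof.
move=> X0; split=> //.
  by apply/closed_agreeP; exact: checksum_shift_closed.
have shX x t : checksum_shift x -> checksum_shift (fun i => x (i + t)).
  move=> Xx K; have [z xz] := Xx K; exists (z - t); exact: aligned_shift.
apply/seteqP; split=> [_ [x Xx <-]|x Xx]; first exact: shX.
exists (fun i => x (i - 1)); first exact: shX.
by apply/funext => i; rewrite /shift_map addrK.
Qed.

(** * Homoclinic classes of the checksum shift *)

(** The marks far from the origin determine the offset: were [z] and [z'] first
    incongruent at level [k.+1], the sites of level [k.+1] for [z'] would be of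
    level [k] for [z], and the two rules prescribe opposite marks there. *)
Lemma homoclinic_offset x x' K z z' k : homoclinic x x' ->
  aligned K z x -> aligned K z' x' -> (k < K)%N -> (scale k %| z' - z)%Z.
Proof.
move=> [M xx'] xz xz'; elim: k => [|k IH] ltk; first by rewrite dvd1z.
have {}IH := IH (ltnW ltk).
apply: contraT => ndvd; pose T := (`|z'| + M).+1.
(* [z' + d] is a far site of level exactly [k.+1] for [z']. *)
pose d : int := (scale k.+1)%:Z * (1 + (ratio k.+1)%:Z * T%:Z).
have dvd_d : (scale k.+1 %| d)%Z by exact: dvdz_mulr.
have ndvd_d : ~~ (scale k.+2 %| d)%Z.
  have sc0 : (scale k.+1)%:Z != 0 by rewrite eqz_nat -lt0n scale_gt0.
  rewrite scaleS (PoszM (ratio k.+1)) mulrC dvdz_mul2l //.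
  rewrite rpredDr ?dvdz_mulr // dvdz1 absz_nat.
  by have := ratio_ge2 k.+1; case: (ratio k.+1) => [|[]].
have x'd : (x' (z' + d)).2 = odd k.+1.
  by apply: (xz' k.+1 ltk).2; rewrite addrAC subrr add0r.
have xd : (x (z' + d)).2 = odd k.
  apply: (xz k (ltnW ltk)).2; rewrite addrAC.
    by rewrite rpredD // (dvdz_scale (leqnSn k)).
  by rewrite rpredDr.
have lt_d : (T <= `|d|)%N.
  rewrite /d abszM absz_nat; apply: leq_trans (leq_pmull _ (scale_gt0 k.+1)).
  have -> : 1 + (ratio k.+1)%:Z * T%:Z = (1 + ratio k.+1 * T)%N by lia.
  rewrite absz_nat; apply: leq_trans (leq_addl _ _).
  by rewrite leq_pmull // (ltnW (ratio_ge2 _)).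
have ltM : (M < `|(z' + d)%R|)%N.
  by clear -lt_d; move: d lt_d; rewrite /T => d lt_d; lia.
by move: x'd; rewrite -(xx' _ ltM) xd [odd k.+1]/=; case: odd.
Qed.

(** A finite set of sites meets some residue class modulo a large [scale k] in
    exactly one site, and the checksum of that class detects a change there. *)
Lemma homoclinic_bits x x' : checksum_shift x -> checksum_shift x' ->
  homoclinic x x' -> forall i, (x i).1 = (x' i).1.
Proof.
move=> Xx Xx' hxx' i; have [M xx'] := hxx'.
have [leiM|/xx' -> //] := leqP `|i| M.
pose k := (2 * M)%N.
have [z xz] := Xx k.+2; have [z' xz'] := Xx' k.+2.
have zz' := homoclinic_offset hxx' xz xz' (ltnSn _).
have [bz _] := xz k (leqnSn _); have [bz' _] := xz' k (leqnSn _).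
have {}bz : balanced (fst \o x) z' k by exact: balanced_mod bz.
(* Write [i] as the [j]-th site of a checksum of level [k]. *)
pose t : int := i - z'; pose r := `|(t %% scale k)%Z|%N.
have sc_gt0 : (0 : int) < (scale k)%:Z by rewrite ltz_nat scale_gt0.
have ra_gt0 : (0 : int) < (ratio k)%:Z by rewrite ltz_nat (ltnW (ratio_ge2 k)).
have rE : r%:Z = (t %% scale k)%Z by rewrite gez0_abs // modz_ge0 // gt_eqF.
have ltr : (r < scale k)%N by rewrite -ltz_nat rE ltz_pmod.
pose q := ((t %/ scale k)%Z %/ ratio k)%Z.
pose j := `|((t %/ scale k)%Z %% ratio k)%Z|%N.
have jE : j%:Z = ((t %/ scale k)%Z %% ratio k)%Z.
  by rewrite gez0_abs // modz_ge0 // gt_eqF.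
have ltj : (j < ratio k)%N by rewrite -ltz_nat jE ltz_pmod.
have iE : cell k z' q r j = i.
  rewrite cellE rE jE.
  have tE := divz_eq t (scale k); have uE := divz_eq (t %/ scale k)%Z (ratio k).
  have -> : i = z' + t by rewrite addrC subrK.
  rewrite [in RHS]tE [in RHS]uE /q; ring.
have := etrans (bz q r ltr) (esym (bz' q r ltr)).
rewrite (bigD1 (Ordinal ltj)) //= [RHS](bigD1 (Ordinal ltj)) //= iE.
rewrite [X in _ + X = _](eq_bigr (fun l : 'I_(ratio k) => (x' (cell k z' q r l)).1)).
  by move=> bits; exact: addIr bits.
move=> l nlj /=; rewrite xx' //.
have -> : cell k z' q r l = i + (l%:Z - j%:Z) * (scale k)%:Z.
  by rewrite -iE !cellE; ring.
have nlj' : (1 <= `|(l%:Z - j%:Z)%R|)%N.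
  by rewrite absz_gt0 subr_eq0 eqz_nat; move: nlj; rewrite -val_eqE.
have := leq_mul nlj' (ltn_scale k); rewrite mul1n -(absz_nat (scale k)) -abszM.
by move: leiM; clear; rewrite /k; move: (_ * _)%R => p; lia.
Qed.

(** A mark not prescribed by the common offset [z] sits at a site congruent to [z]
    modulo each [scale k]; two such sites are congruent modulo each [scale k]. *)
Lemma homoclinic_marks x x' i j : checksum_shift x -> checksum_shift x' ->
  homoclinic x x' -> (x i).2 <> (x' i).2 -> (x j).2 <> (x' j).2 -> i = j.
Proof.
move=> Xx Xx' hxx' neqi neqj.
pose K := `|i - j|%N.
have [z xz] := Xx K.+1; have [z' xz'] := Xx' K.+1.
have level0 l : (x l).2 <> (x' l).2 ->
    forall k, (k <= K)%N -> (scale k %| l - z)%Z.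
  move=> neql; elim=> [|k IH] ltk; first by rewrite dvd1z.
  apply: contraT => ndvd; case: neql.
  have dvdk := IH (ltnW ltk).
  have zz' := homoclinic_offset hxx' xz xz' (ltk : (k.+1 < K.+1)%N).
  have lE : l - z' = (l - z) - (z' - z) by ring.
  rewrite [LHS]((xz k (ltnW ltk)).2 l) // [RHS]((xz' k (ltnW ltk)).2 l) //.
    by rewrite lE rpredBr // (dvdz_scale (leqnSn k)).
  by rewrite lE rpredBr.
have dvd_ij : (scale K %| i - j)%Z.
  have -> : i - j = (i - z) - (j - z) by ring.
  by rewrite rpredB // level0.
have /dvdnP[t] : (scale K %| `|(i - j)%R|)%N := dvd_ij.
have := ltn_scale K; case: t => [|t]; first by lia.
by rewrite mulSn -/K; lia.
Qed.

Lemma checksum_shift_homoclinic_le2 : homoclinic_classes_le2 checksum_shift.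
Proof.
move=> x y z Xx Xy Xz hxy hxz.
have hyz : homoclinic y z.
  have [M xy] := hxy; have [N xz] := hxz; exists (M + N)%N => i lti.
  by rewrite -xy -?xz //; lia.
have bits u v : checksum_shift u -> checksum_shift v -> homoclinic u v ->
    forall i, (u i).2 = (v i).2 -> u i = v i.
  move=> Xu Xv huv i; have := homoclinic_bits Xu Xv huv i.
  by case: (u i) (v i) => [? ?] [? ?] /= -> ->.
have [xy|nxy] := pselect (forall i, (x i).2 = (y i).2).
  by constructor 1; apply/funext => i; exact: bits.
have [xz|nxz] := pselect (forall i, (x i).2 = (z i).2).
  by constructor 2; apply/funext => i; exact: bits.
have /existsNP[i neqi] := nxy; have /existsNP[j neqj] := nxz.
have ij : i = j.
  apply: contrapT => neq_ij.
  have xzi : (x i).2 = (z i).2.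
    by apply: contrapT => nxzi; apply: neq_ij; apply: homoclinic_marks nxzi _.
  have xyj : (x j).2 = (y j).2.
    by apply: contrapT => nxyj; apply: neq_ij; apply: homoclinic_marks nxyj.
  apply: neq_ij; apply: (homoclinic_marks Xy Xz hyz); first by rewrite -xzi => /esym.
  by rewrite -xyj.
subst j; constructor 3; apply/funext => l; apply: bits => //.
have yzi : (y i).2 = (z i).2 by move: neqi neqj; do 3!case: (_.2).
have [xyl|/eqP xyl] := eqVneq (x l).2 (y l).2; last first.
  by rewrite (homoclinic_marks Xx Xy hxy xyl neqi).
have [xzl|/eqP xzl] := eqVneq (x l).2 (z l).2; first by rewrite -xyl.
by rewrite (homoclinic_marks Xx Xz hxz xzl neqj).
Qed.

(** * Extending balanced words to points *)

(** The digit of level [l] of [i] in the mixed radix system with bases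
    [ratio 0], [ratio 1], and so on; it is nonnegative also for negative [i]. *)
Definition digit (l : nat) (i : int) : int :=
  ((i %/ (scale l)%:Z)%Z %% (ratio l)%:Z)%Z.

(** All digits of [i] from level [K] on are [0] or [1]. *)
Definition low_digits (K : nat) (i : int) := forall l, (K <= l)%N -> digit l i < 2.

Lemma scale_neq0 k : (scale k)%:Z != 0.
Proof. by rewrite eqz_nat -lt0n scale_gt0. Qed.

Lemma offset_lt k r j : (r < scale k)%N -> (j < ratio k)%N ->
  (r + j * scale k < scale k.+1)%N.
Proof.
move=> ltr ltj; rewrite scaleS; apply: leq_trans (leq_mul ltj (leqnn _)).
by rewrite mulSn ltn_add2r.
Qed.

(** Along a checksum of level [k] with offset [0], only the digit of level [k]
    varies, and it runs through all its values. *)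
Lemma digit_cell_neq l k q r j : (r < scale k)%N -> (j < ratio k)%N -> l != k ->
  digit l (cell k 0 q r j) = digit l (cell k 0 q r 0).
Proof.
move=> ltr ltj; rewrite neq_ltn => /orP[ltlk|ltkl].
  have /dvdnP[t tE] := dvdn_scale ltlk.
  have -> : cell k 0 q r j =
      j%:Z * t%:Z * (ratio l)%:Z * (scale l)%:Z + cell k 0 q r 0.
    by rewrite !cellE tE scaleS (PoszM t) (PoszM (ratio l)); ring.
  by rewrite /digit divzMDl ?scale_neq0 // modzMDl.
have /dvdnP[t tE] := dvdn_scale ltkl.
suff H j' : (j' < ratio k)%N -> (cell k 0 q r j' %/ scale k.+1)%Z = q.
  rewrite /digit tE mulnC (PoszM (scale k.+1)) !divzMA_ge0 //.
  by rewrite !H // (ltnW (ratio_ge2 k)).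
move=> lt'; rewrite /cell add0r divzMDl ?scale_neq0 // divz_small ?addr0 //.
by rewrite absz_nat ltz_nat offset_lt.
Qed.

Lemma digit_cell_eq k q r j : (r < scale k)%N -> (j < ratio k)%N ->
  digit k (cell k 0 q r j) = j.
Proof.
move=> ltr ltj; rewrite /digit cellE add0r divzMDl ?scale_neq0 //.
rewrite [(r %/ _)%Z]divz_small ?addr0; last by rewrite ltz_nat.
by rewrite modzMDl modz_small // ltz_nat.
Qed.

Lemma low_digits_cell K k q r j : (r < scale k)%N -> (j < ratio k)%N ->
  low_digits K (cell k 0 q r j) <->
  low_digits K (cell k 0 q r 0) /\ ((K <= k)%N -> (j < 2)%N).
Proof.
move=> ltr ltj; split=> [low|[low ltj2] l leKl].
  split=> [l leKl|leKk]; last first.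
    by have := low k leKk; rewrite digit_cell_eq.
  have [->|nlk] := eqVneq l k.
    by rewrite digit_cell_eq // (ltnW (ratio_ge2 k)).
  by rewrite -(digit_cell_neq q ltr ltj nlk) low.
have [lk|nlk] := eqVneq l k.
  by rewrite lk digit_cell_eq // ltz_nat ltj2 // -lk.
by rewrite digit_cell_neq // low.
Qed.

(** The extension of a word [w] of length [scale K]: a copy of [w] in each aligned
    block of that length whose sites have low digits, and [0] elsewhere. *)
Definition periodize (K : nat) (w : nat -> 'F_2) (i : int) : 'F_2 :=
  if `[< low_digits K i >] then w `|(i %% (scale K)%:Z)%Z|%N else 0.

(** The checksums of levels below [K] inside one block of length [scale K]
    vanish. *)
Definition balanced_word (K : nat) (w : nat -> 'F_2) :=
  forall k, (k < K)%N -> forall q r,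
    (q < scale K %/ scale k.+1)%N -> (r < scale k)%N ->
    \sum_(j < ratio k) w (q * scale k.+1 + (r + j * scale k))%N = 0.

(** A checksum of level [k >= K] contains two equal bits, at digits [0] and [1],
    and otherwise zeros. A checksum of level [k < K] lies in a single block of
    length [scale K], which is either a copy of [w] or zero. *)
Lemma balanced_periodize K w k : balanced_word K w ->
  balanced (periodize K w) 0 k.
Proof.
move=> bw q r ltr; have [leKk|ltkK] := leqP K k.
  have -> : \sum_(j < ratio k) periodize K w (cell k 0 q r j) =
      \sum_(j < ratio k | (j < 2)%N) periodize K w (cell k 0 q r 0).
    rewrite [RHS]big_mkcond; apply: eq_bigr => j _.
    have /dvdnP[t tE] := dvdn_scale leKk.
    have cE : cell k 0 q r j = j%:Z * t%:Z * (scale K)%:Z + cell k 0 q r 0.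
      by rewrite !cellE tE (PoszM t); ring.
    have modE : (cell k 0 q r j %% scale K)%Z = (cell k 0 q r 0 %% scale K)%Z.
      by rewrite cE modzMDl.
    have lowE : `[< low_digits K (cell k 0 q r j) >] =
        `[< low_digits K (cell k 0 q r 0) >] && (j < 2)%N.
      have lowP := low_digits_cell K q ltr (ltn_ord j).
      apply/asboolP/andP => [/lowP[low ltj2]|[/asboolP low ltj2]].
        by split; [exact/asboolP|exact: ltj2].
      exact/lowP.
    by rewrite /periodize modE lowE; case: (j < 2)%N; case: asbool.
  rewrite -(big_ord_widen _ (fun=> periodize K w (cell k 0 q r 0)) (ratio_ge2 k)).
  rewrite sumr_const card_ord -mulr_natr.
  have -> : 2%:R = 0 :> 'F_2 by exact: val_inj.
  by rewrite mulr0.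
have lowE j : (j < ratio k)%N -> `[< low_digits K (cell k 0 q r j) >] =
    `[< low_digits K (cell k 0 q r 0) >].
  move=> ltj; have lowP := low_digits_cell K q ltr ltj.
  apply/asboolP/asboolP => [/lowP[]//|low]; apply/lowP; split=> //.
  by rewrite leqNgt ltkK.
rewrite /periodize; under eq_bigr => j _ do rewrite lowE //.
case: asbool; last by rewrite big1.
have /dvdnP[t tE] := dvdn_scale ltkK.
have t0 : t%:Z != 0.
  by rewrite eqz_nat; apply: contraTneq (scale_gt0 K) => t0; rewrite tE t0.
pose q' := `|(q %% t%:Z)%Z|%N.
have q'E : q'%:Z = (q %% t%:Z)%Z by rewrite gez0_abs // modz_ge0.
have ltq' : (q' < t)%N.
  rewrite -ltz_nat q'E ltz_pmod // ltz_nat lt0n.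
  by rewrite -eqz_nat.
rewrite -[RHS](bw k ltkK q' r) //; last by rewrite tE mulnK ?scale_gt0.
apply: eq_bigr => j _; congr w.
have -> : cell k 0 q r j =
    (q %/ t%:Z)%Z * (scale K)%:Z + (q' * scale k.+1 + (r + j * scale k))%N%:Z.
  rewrite /cell tE !PoszD (PoszM t) (PoszM q') q'E [in LHS](divz_eq q t); ring.
rewrite modzMDl modz_small ?absz_nat // ltz_nat tE /=.
apply: leq_trans (leq_mul ltq' (leqnn (scale k.+1))).
by rewrite mulSn addnC ltn_add2r offset_lt.
Qed.

(** The marks for the offset [0]; the site [0], which has no level, is given the
    mark [false]. *)
Definition level_mark (i : int) : bool :=
  `[< exists k, [/\ odd k, (scale k %| i)%Z & ~~ (scale k.+1 %| i)%Z] >].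

Lemma ruled_level_mark k : ruled level_mark 0 k.
Proof.
move=> i; rewrite subr0 => dvdi ndvdi.
apply/asboolP/idP => [[l [oddl dvdl ndvdl]]|oddk]; last by exists k.
suff -> : k = l by [].
apply/eqP; rewrite eqn_leq; apply/andP; split; rewrite leqNgt; apply/negP => lt.
  by rewrite (dvdz_scale lt dvdi) in ndvdl.
by rewrite (dvdz_scale lt dvdl) in ndvdi.
Qed.

Lemma checksum_shift_periodize K w : balanced_word K w ->
  checksum_shift (fun i => (periodize K w i, level_mark i)).
Proof.
move=> bw L; exists 0 => k _; split; first exact: balanced_periodize.
exact: ruled_level_mark.
Qed.

Lemma checksum_shift_neq0 : checksum_shift !=set0.
Proof.
exists (fun i => (periodize 0 (fun=> 0) i, level_mark i)).
by apply: checksum_shift_periodize.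
Qed.

Lemma periodize_small K w j : (j < scale K)%N -> periodize K w j%:Z = w j.
Proof.
move=> ltj; rewrite /periodize modz_small ?ltz_nat //= ifT //.
apply/asboolP => l leKl; rewrite /digit divz_small ?mod0z //=.
by rewrite ltz_nat (leq_trans ltj) // dvdn_leq ?scale_gt0 ?dvdn_scale.
Qed.

(** * Counting balanced words *)

(** Elements of the fibre over [v] of a difference-preserving map inject into
    the kernel by subtracting one of them. *)
Lemma card_le_kernel (I J : finType) (V : finZmodType)
    (f : {ffun I -> V} -> {ffun J -> V}) :
  {morph f : x y / x - y} ->
  (#|V| ^ #|I| <= #|[set u | f u == 0%R]%SET| * #|V| ^ #|J|)%N.
Proof.
move=> fB; pose ker := [set u | f u == 0%R]%SET.
have fibre v : (\sum_(u | f u == v) 1 <= #|ker|)%N.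
  rewrite sum1dep_card.
  have [->|[u0]] := set_0Vmem [set u | f u == v]%SET; first by rewrite cards0.
  rewrite inE => /eqP fu0.
  rewrite -(card_imset _ (subIr u0)); apply: subset_leq_card.
  apply/fintype.subsetP => _ /imsetP[u fu ->]; move: fu.
  by rewrite !inE fB fu0 => /eqP ->; rewrite subrr.
rewrite -!card_ffun -[leqLHS]sum1_card (partition_big f predT) //=.
apply: leq_trans (leq_sum _ (fun v _ => fibre v)) _.
by rewrite sum_nat_const mulnC.
Qed.

(** The checksums inside one block of length [scale K], indexed by the level, the
    position of the sub-block and the residue. *)
Definition equation (K : nat) : finType :=
  {k : 'I_K & ('I_(scale K %/ scale k.+1) * 'I_(scale k))%type}.

Lemma card_equation K : (#|equation K| * 2 <= scale K)%N.
Proof.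
have -> : #|equation K| = (\sum_(k < K) (scale K %/ scale k.+1) * scale k)%N.
  rewrite card_tagged sumnE big_map big_enum /=.
  by apply: eq_bigr => k _; rewrite card_prod !card_ord.
pose c K := (\sum_(k < K) (scale K %/ scale k.+1) * scale k)%N.
have cS L : c L.+1 = (ratio L * c L + scale L)%N.
  have lastE : ((scale L.+1 %/ scale L.+1) * scale L = scale L)%N.
    by rewrite divnn scale_gt0 mul1n.
  rewrite /c big_ord_recr; congr addn; last exact: lastE.
  rewrite big_distrr; apply: eq_bigr => k _ /=.
  by rewrite mulnA muln_divA //; exact: dvdn_scale (ltn_ord k).
(* By induction on [L], in the sharper form
   [c L <= (1 - 1 / 2 ^ L) * scale L / 2]. *)
have bound L : (2 ^ L * (c L * 2) + scale L <= 2 ^ L * scale L)%N.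
  elim: L => [|L IH]; first by rewrite /c big_ord0.
  rewrite cS scaleS.
  have -> : ratio L = (4 * 2 ^ L)%N by rewrite /ratio !expnS mulnA.
  rewrite expnS; move: IH; move: (2 ^ L)%N (c L) (scale L) => e a n; nia.
have := bound K; have := expn_gt0 2 K; rewrite -/(c K); nia.
Qed.

(** The word given by a finite function, continued by [0]. *)
Definition word_of (n : nat) (w : {ffun 'I_n -> 'F_2}) (i : nat) : 'F_2 :=
  if insub i is Some j then w j else 0.

(** The values of all checksums of a word. *)
Definition syndrome (K : nat) (w : {ffun 'I_(scale K) -> 'F_2}) :
    {ffun equation K -> 'F_2} :=
  [ffun e : equation K => \sum_(j < ratio (tag e))
     word_of w ((tagged e).1 * scale (tag e).+1
                + ((tagged e).2 + j * scale (tag e)))%N].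

Lemma syndromeB K : {morph @syndrome K : v w / v - w}.
Proof.
move=> v w; apply/ffunP => e; rewrite !ffunE -sumrB; apply: eq_bigr => j _.
by rewrite /word_of; case: insubP => [i _ _|_]; rewrite ?ffunE ?subr0.
Qed.

Lemma syndrome_balanced K w : @syndrome K w = 0 -> balanced_word K (word_of w).
Proof.
move=> /ffunP w0 k ltk q r ltq ltr.
pose e : equation K :=
  existT (fun k : 'I_K => ('I_(scale K %/ scale k.+1) * 'I_(scale k))%type)
    (Ordinal ltk) (Ordinal ltq, Ordinal ltr).
by have := w0 e; rewrite !ffunE.
Qed.

(** There are at least [2 ^ (scale K - c)] balanced words, where [c] is the number
    of checksums and [2 * c <= scale K]; the bound is squared to avoid halving. *)
Lemma card_blocks_checksum_shift K :
  (2 ^ scale K <= #|blocks checksum_shift (scale K)| ^ 2)%N.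
Proof.
pose n := scale K; pose ker := [set w | @syndrome K w == 0]%SET.
pose pt (w : {ffun 'I_n -> 'F_2}) (i : int) : letter :=
  (periodize K (word_of w) i, level_mark i).
have ker_blocks : (#|ker| <= #|blocks checksum_shift n|)%N.
  have inj : injective (fun w => window (pt w) 0 n).
    move=> v w vw; apply/ffunP => i; have := congr1 (fun t => (tnth t i).1) vw.
    by rewrite !tnth_mktuple /= !add0r !periodize_small // /word_of !valK.
  rewrite -(card_imset _ inj); apply: subset_leq_card.
  apply/fintype.subsetP => _ /imsetP[w wker ->]; move: wker.
  rewrite inE => /eqP/syndrome_balanced bw; rewrite inE; apply/asboolP.
  exists (pt w).
    exact: checksum_shift_periodize.
  by exists 0.
have := card_le_kernel (@syndromeB K).
rewrite card_Fp // card_ord -/ker => le_ker.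
have le_ker2 : (2 ^ n <= #|ker| ^ 2)%N.
  rewrite -(leq_pmul2r (_ : 0 < 2 ^ n)%N) ?expn_gt0 //.
  apply: leq_trans (_ : (#|ker| * 2 ^ #|equation K|) ^ 2 <= _)%N.
    by rewrite mulnn leq_sqr.
  by rewrite expnMn -expnM leq_mul2l leq_exp2l // card_equation orbT.
by apply: leq_trans le_ker2 _; rewrite leq_sqr.
Qed.

Lemma entropy_checksum_shift_gt0 (R : realType) : 0 < entropy R checksum_shift.
Proof.
have ln2_gt0 : 0 < ln (2 : R) by rewrite ln_gt0 // ltr1n.
apply: lt_le_trans (_ : 0 < ln 2 / 2) _; first by rewrite divr_gt0.
apply: entropy_ge; first exact: checksum_shift_neq0.
move=> N; exists (scale N); first exact: ltn_scale.
have cardB := card_blocks_checksum_shift N.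
have B_gt0 : (0 < #|blocks checksum_shift (scale N)|)%N.
  by have := leq_trans (expn_gt0 2 (scale N)) cardB; rewrite expn_gt0 orbF.
have : ln ((2 : R) ^+ scale N) <= ln (#|blocks checksum_shift (scale N)|%:R ^+ 2).
  by rewrite ler_ln ?posrE ?exprn_gt0 ?ltr0n // -!natrX ler_nat.
rewrite !lnXn ?ltr0n // => le2.
by rewrite mulrAC ler_pdivrMr // mulr_natr mulr_natr.
Qed.

Theorem theorem1p2 (R : realType) :
  exists (A : finType) (X : set (int -> A)),
    [/\ shift_space X, 0 < entropy R X & sup_ind_entropy R X = 0%:E].
Proof.
have shX := shift_space_checksum_shift checksum_shift_neq0.
exists letter, checksum_shift; split=> //; first exact: entropy_checksum_shift_gt0.
have ind0 (B : finType) (Y : set (int -> B)) :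
    conjugate checksum_shift Y -> ind_entropy R Y = 0.
  move=> XY; apply: ind_entropy0.
  exact: conjugate_homoclinic_le2 shX XY checksum_shift_homoclinic_le2.
apply/eqP; rewrite eq_le; apply/andP; split.
  by apply: ge_ereal_sup => _ [B [Y [_ XY ->]]]; rewrite ind0.
apply: ereal_sup_ubound; exists letter, checksum_shift.
have XX := conjugate_refl checksum_shift.
by rewrite (ind0 _ _ XX).
Qed.
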